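(* Let $K$ be a compact space. Then the following three cardinal numbers coincide: \begin{enumerate} \item[(1)] $c(K^{(\infty)},K)$; \item[(2)] $\sup\{|\Gamma| : C(K_{\Gamma,[0,1]})\text{ embeds positively isometrically into }C(K)\}$; \item[(3)] $\sup\{|\Gamma| : C(K_{\Gamma,[0,1]})\text{ embeds isometrically into }C(K)\}$. \end{enumerate} If, moreover, $K$ is zero-dimensional, then the three cardinal numbers (1), (2) and (3) coincide also with the following two: \begin{enumerate} \item[(4)] $\sup\{|\Gamma| : K\text{ maps continuously onto }K_{\Gamma,\Delta}\}$; \item[(5)] $\sup\{|\Gamma| : C(K_{\Gamma,\Delta})\text{ embeds lattice and algebraically isometrically into }C(K)\}$. \end{enumerate}
   Context: All compact spaces are Hausdorff (and nonempty, since Banach spaces are assumed real and of dimension at least one). A space is zero-dimensional if it has a base of clopen sets. $\Delta$ is the standard Cantor space. $C(K)$ is the Banach space of continuous real-valued functions on $K$ with the supremum norm, and is a Banach lattice and Banach algebra with pointwise operations. Isometric embeddings are linear; a positive isometric embedding is one mapping nonnegative functions to nonnegative functions; a lattice and algebraically isometric embedding is an isometric embedding which also preserves the lattice operations and multiplication. Cantor--Bendixson derivatives: $S^{(0)}=S$, $S^{(1)}$ is the set of accumulation points of $S$, $S^{(\beta+1)}=(S^{(\beta)})^{(1)}$, and $S^{(\alpha)}=\bigcap_{\beta<\alpha}S^{(\beta)}$ for limit $\alpha$. The perfect kernel $S^{(\infty)}$ is the eventual constant value of $S^{(\alpha)}$. A cellular family in $S$ is a family of pairwise disjoint nonempty open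 subsets of $S$. For $A\subseteq S$, the relative cellularity $c(A,S)$ is the supremum of the cardinalities of cellular families $\mathcal U$ in $S$ such that $A\cap U\ne\emptyset$ for every $U\in\mathcal U$. For a nonempty set $\Gamma$ and a nonempty compact space $L$, $K_{\Gamma,L}$ is the one-point compactification of the disjoint union of $|\Gamma|$ many copies of $L$ if $\Gamma$ is infinite, and simply the disjoint union of $|\Gamma|$ copies of $L$ if $\Gamma$ is finite. Suprema are over nonempty sets $\Gamma$, and the supremum of the empty set is $0$. *)

(* Defs.v *)
From HB Require Import structures.
From mathcomp Require Import all_boot all_order all_algebra.
From mathcomp Require Import all_classical all_reals all_analysis.

Set Implicit Arguments.
Unset Strict Implicit.
Unset Printing Implicit Defensive.

Import Order.TTheory GRing.Theory Num.Theory.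
Import numFieldNormedType.Exports.

Local Open Scope classical_set_scope.
Local Open Scope card_scope.
Local Open Scope ring_scope.

(* A cardinal number is represented by a type, up to equipotence: the order is
   [#<=] and equality is [#=] on full sets.  A supremum is a least upper bound
   for that order; it is unique up to [#=] (lemma [card_supU]), and it is an
   empty type when no [Gamma] satisfies [P]. *)

Definition is_card_sup (P : Type -> Prop) (kappa : Type) : Prop :=
  (forall Gamma : Type, P Gamma -> [set: Gamma] #<= [set: kappa]) /\
  (forall mu : Type, (forall Gamma : Type, P Gamma -> [set: Gamma] #<= [set: mu]) ->
     [set: kappa] #<= [set: mu]).

Lemma card_supU (P : Type -> Prop) (kappa lambda : Type) :
  is_card_sup P kappa -> is_card_sup P lambda -> [set: kappa] #= [set: lambda].
Proof.
move=> [ubk lek] [ubl lel].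
by rewrite card_eq_le (lek _ ubl) (lel _ ubk).
Qed.

(* Ordinals are denoted by well-founded trees; [ord_lim f] is the supremum of
   the family [f], which covers all limit ordinals.  Distinct trees may denote
   the same ordinal; [ord_le] is the order of the denoted ordinals. *)

Inductive ordinal_tree : Type :=
| ord_zero
| ord_succ (a : ordinal_tree)
| ord_lim (I : Type) (f : I -> ordinal_tree).

Inductive ord_le : ordinal_tree -> ordinal_tree -> Prop :=
| ord_le_zero b : ord_le ord_zero b
| ord_le_succ a : ord_le a (ord_succ a)
| ord_le_succ2 a b : ord_le a b -> ord_le (ord_succ a) (ord_succ b)
| ord_le_lim I (f : I -> ordinal_tree) i : ord_le (f i) (ord_lim f)
| ord_lim_le I (f : I -> ordinal_tree) b :
    (forall i, ord_le (f i) b) -> ord_le (ord_lim f) b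
| ord_le_trans a b c : ord_le a b -> ord_le b c -> ord_le a c.

Section CantorBendixson.
Context {S : topologicalType}.

(* accumulation points of the subspace [A], inside that subspace *)
Definition derived (A : set S) : set S := A `&` limit_point A.

(* The family being decreasing, at a limit ordinal it does not matter whether
   one intersects over all smaller ordinals or over a cofinal family. *)
Fixpoint cb_derivative (a : ordinal_tree) : set S :=
  match a with
  | ord_zero => setT
  | ord_succ b => derived (cb_derivative b)
  | ord_lim J f => \bigcap_(j : J) cb_derivative (f j)
  end.

(* the eventual constant value of the derivatives *)
Definition perfect_kernel : set S :=
  xget set0 [set A | exists a, forall b, ord_le a b -> cb_derivative b = A].

Lemma derivedS (A B : set S) : A `<=` B -> derived A `<=` derived B.
Proof.
move=> AB x [Ax lx]; split; first exact: AB.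
by move=> U /lx[y [yx Ay Uy]]; exists y; split => //; exact: AB.
Qed.

Lemma cb_derivative_anti a b :
  ord_le a b -> cb_derivative b `<=` cb_derivative a.
Proof.
elim=> //=.
- by move=> c x [].
- by move=> c d _; exact: derivedS.
- by move=> I f i x; exact.
- by move=> I f c _ sub x cx i _; exact: sub.
- by move=> c d e _ dc _ ed; exact: subset_trans ed dc.
Qed.

Lemma cb_derivative_stationary : exists A : set S,
  exists a, forall b, ord_le a b -> cb_derivative b = A.
Proof.
pose P (x : S) := exists a, ~ cb_derivative a x.
have /choice[f fP] (x : {x | P x}) : exists a, ~ cb_derivative a (projT1 x).
  exact: projT2 x.
exists (cb_derivative (ord_lim f)), (ord_lim f) => b le_b.
apply/seteqP; split; first exact: cb_derivative_anti.
move=> x fx; apply: contrapT => nbx.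
by apply: (fP (exist P x (ex_intro _ b nbx))); exact: fx.
Qed.

Lemma perfect_kernelP :
  exists a, forall b, ord_le a b -> cb_derivative b = perfect_kernel.
Proof.
rewrite /perfect_kernel; case: xgetP => [_ _ //|nA].
by have [A] := cb_derivative_stationary; move/nA.
Qed.

End CantorBendixson.
Arguments perfect_kernel : clear implicits.

Definition cellular_family {S : topologicalType} (U : set (set S)) : Prop :=
  (forall V, U V -> open V /\ V !=set0) /\ trivIset U id.

(* the cardinality of [Gamma] is that of a cellular family meeting [A] *)
Definition has_cellular_family {S : topologicalType} (A : set S)
    (Gamma : Type) : Prop :=
  exists U : set (set S), [/\ cellular_family U,
    (forall V, U V -> A `&` V !=set0) & U #= [set: Gamma]].

Definition is_relative_cellularity {S : topologicalType} (A : set S) :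
  Type -> Prop := is_card_sup (has_cellular_family A).

(* The library's [zero_dimensional] only asks that clopen sets separate points. *)
Definition has_clopen_base (S : topologicalType) : Prop :=
  exists2 B : set (set S), basis B & B `<=` clopen.

(* [{classic Gamma}] only equips [Gamma] with the choiceType structure that the
   library requires of the index of a topological sum. *)
Definition copies_space (Gamma : Type) (L : topologicalType) : topologicalType :=
  if pselect (finite_set [set: Gamma])
  then ({_ : {classic Gamma} & L} : topologicalType)
  else (one_point_compactification {_ : {classic Gamma} & L} : topologicalType).

Definition unit_interval (R : realType) : topologicalType :=
  set_type (`[0, 1]%classic : set R).

Definition Cspace (R : realType) (K : topologicalType) : Type :=
  continuousType K R.

Section Cspace.
Context {R : realType} {K : topologicalType}.
Local Notation C := (Cspace R K).
Implicit Types f g h : C.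

HB.instance Definition _ := Choice.on C.

Let cts_cst (a : R) : continuous (fun _ : K => a).
Proof. by move=> x; exact: cvg_cst. Qed.

Let cts_add f g : continuous (fun x => f x + g x).
Proof. by move=> x; apply: (@continuousD R R^o); exact: cts_fun. Qed.

Let cts_opp f : continuous (fun x => - f x).
Proof. by move=> x; apply: (@continuousN R R^o); exact: cts_fun. Qed.

Let cts_mul f g : continuous (fun x => f x * g x).
Proof. by move=> x; apply: continuousM; exact: cts_fun. Qed.

Let cts_scale (a : R) f : continuous (fun x => a * f x).
Proof. by move=> x; apply: continuousM; [exact: cvg_cst|exact: cts_fun]. Qed.

Let cts_max f g : continuous (fun x => Num.max (f x) (g x)).
Proof. by move=> x; apply: continuous_max; exact: cts_fun. Qed.

Let cts_min f g : continuous (fun x => Num.min (f x) (g x)).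
Proof. by move=> x; apply: continuous_min; exact: cts_fun. Qed.

Definition czero : C := (mkcts (@cts_cst 0) : continuousType K R).
Definition cadd f g : C := (mkcts (@cts_add f g) : continuousType K R).
Definition copp f : C := (mkcts (@cts_opp f) : continuousType K R).
Definition cscale (a : R) f : C := (mkcts (@cts_scale a f) : continuousType K R).
Definition cmul f g : C := (mkcts (@cts_mul f g) : continuousType K R).
Definition cmax f g : C := (mkcts (@cts_max f g) : continuousType K R).
Definition cmin f g : C := (mkcts (@cts_min f g) : continuousType K R).

Let caddA : associative cadd.
Proof. by move=> f g h; apply/continuousEP => x; exact: addrA. Qed.

Let caddC : commutative cadd.
Proof. by move=> f g; apply/continuousEP => x; exact: addrC. Qed.

Let cadd0 : left_id czero cadd.
Proof. by move=> f; apply/continuousEP => x; exact: add0r. Qed.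

Let caddN : left_inverse czero copp cadd.
Proof. by move=> f; apply/continuousEP => x; exact: addNr. Qed.

HB.instance Definition _ := GRing.isZmodule.Build C caddA caddC cadd0 caddN.

Let cscaleA a b f : cscale a (cscale b f) = cscale (a * b) f.
Proof. by apply/continuousEP => x; exact: mulrA. Qed.

Let cscale1 : left_id 1 cscale.
Proof. by move=> f; apply/continuousEP => x; exact: mul1r. Qed.

Let cscaleDr : right_distributive cscale +%R.
Proof. by move=> a f g; apply/continuousEP => x; exact: mulrDr. Qed.

Let cscaleDl f : {morph cscale^~ f : a b / a + b}.
Proof. by move=> a b; apply/continuousEP => x; exact: mulrDl. Qed.

HB.instance Definition _ := GRing.Zmodule_isLmodule.Build R C
  cscaleA cscale1 cscaleDr cscaleDl.

(* the supremum norm when [K] is nonempty and compact *)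
Definition csupnorm f : R := sup (range (fun x => `|f x|)).

End Cspace.

Section Embeddings.
Context {R : realType} {L K : topologicalType}.
Implicit Type T : {linear Cspace R L -> Cspace R K}.

Definition isometric_embedding T : Prop :=
  forall f, csupnorm (T f) = csupnorm f.

Definition positive_operator T : Prop :=
  forall f : Cspace R L, (forall x, 0 <= f x) -> forall y, 0 <= T f y.

Definition lattice_preserving T : Prop :=
  {morph T : f g / cmax f g} /\ {morph T : f g / cmin f g}.

Definition multiplicative_operator T : Prop := {morph T : f g / cmul f g}.

End Embeddings.

Definition embeds_isometrically (R : realType) (L K : topologicalType) : Prop :=
  exists T : {linear Cspace R L -> Cspace R K}, isometric_embedding T.

Definition embeds_positively_isometrically (R : realType)
    (L K : topologicalType) : Prop :=
  exists2 T : {linear Cspace R L -> Cspace R K},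
    isometric_embedding T & positive_operator T.

Definition embeds_lattice_algebraically_isometrically (R : realType)
    (L K : topologicalType) : Prop :=
  exists T : {linear Cspace R L -> Cspace R K},
    [/\ isometric_embedding T, lattice_preserving T
      & multiplicative_operator T].

Definition maps_continuously_onto (K L : topologicalType) : Prop :=
  exists2 f : K -> L, continuous f & range f = setT.

(* Main.v *)
From HB Require Import structures.
Require Import Defs.
From mathcomp Require Import all_boot all_order all_algebra.
From mathcomp Require Import all_classical all_reals all_analysis.
From mathcomp Require Import lra.
Local Open Scope classical_set_scope.

Set Implicit Arguments.
Unset Strict Implicit.
Unset Printing Implicit Defensive.

Import Order.TTheory GRing.Theory Num.Theory.
Import numFieldNormedType.Exports.

(* For a nonempty [Gamma] the five conditions are equivalent, so that the five
   suprema agree as soon as one of them exists.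
   From a cellular family to an embedding: the perfect kernel has no isolated
   points, so each cell contains a closed set (a clopen one when [K] is
   zero-dimensional) mapping onto the Cantor space, hence onto [0,1], and the
   copies are glued along the cells, everything else being sent to infinity.
   From an isometric embedding [T] to a cellular family: the cells are the sets
   where [|T 1_c| > 1/2], with [1_c] the indicator of the copy [c]; they are
   disjoint because [|T 1_c| + |T 1_c'| <= 1].  To see that such a cell meets
   the perfect kernel, take a minimal closed subset [E] of [|T 1_c| = 1] on which
   [T f] attains the norm of every [f] supported by the copy.  An isolated point
   [x] of [E] would be the only point of [E] where some [|T f|] is close to the
   norm of [f]; two disjoint bumps [g1], [g2] supported where [f] is nearly
   maximal would then satisfy [|T g1 x| + |T g2 x| > 1], which is impossible.
   So [E] is dense in itself, and is contained in the perfect kernel. *)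

(** * Existence of cardinal suprema *)

Section Cardinals.
Local Open Scope card_scope.

Lemma injective_card_le (T U : Type) (f : T -> U) :
  injective f -> [set: T] #<= [set: U].
Proof.
move=> fI; have [g _] : exists g : {injfun [set: T] >-> [set: U]}, True.
  have : $|{injfun [set: T] >-> [set: U]}|.
    by apply/injfunPex; exists f => // x y _ _; exact: fI.
  by move=> [g]; exists g.
exact: inj_card_le g.
Qed.

(* Hoenig's argument: a maximal set of choice functions that are pairwise
   distinct at every index projects onto one of the types. *)
Lemma card_family_min (I : Type) (A : I -> Type) (i0 : I) :
  exists i, forall j, [set: A i] #<= [set: A j].
Proof.
pose P (G : set (forall i, A i)) :=
  forall g h, G g -> G h -> forall i, g i = h i -> g = h.
have [F FP Ftot|G [PG Gmax]] := @Zorn_bigcup _ P.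
  move=> g h [X FX Xg] [Y FY Yh] i ghi.
  have [XY|YX] := Ftot _ _ FX FY.
  - by apply: (FP _ FY _ _ _ _ i) => //; exact: XY.
  - by apply: (FP _ FX _ _ _ _ i) => //; exact: YX.
have [i iG] : exists i, forall a : A i, exists2 g, G g & g i = a.
  apply: contrapT => /forallNP nG.
  have fresh i : exists a : A i, forall g, G g -> g i <> a.
    by have /existsNP[a aG] := nG i; exists a => g Gg gia; apply: aG; exists g.
  pose f i := projT1 (cid (fresh i)).
  have fP i g : G g -> g i <> f i by exact: (projT2 (cid (fresh i))).
  apply: (Gmax (G `|` [set f])).
    split; first by move=> g Gg; left.
    move=> /(_ f) GffG; have Gf : G f by apply: GffG; right.
    exact: (fP i0 f Gf).
  move=> g h [Gg|->] [Gh|->] // i.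
  - exact: PG.
  - by move=> /fP; move/(_ Gg).
  - by move=> /esym/fP; move/(_ Gh).
exists i => j.
apply: (@card_le_trans _ _ _ G).
  have <- : (fun g => g i) @` G = [set: A i].
    by apply/seteqP; split=> // a _; have [g Gg <-] := iG a; exists g.
  exact: card_image_le.
have GI : {in G &, injective (fun g : forall i, A i => g j)}.
  by move=> g h /set_mem Gg /set_mem Gh; exact: PG.
apply: card_le_trans (card_leT ((fun g => g j) @` G)).
by have := inj_card_eq GI; rewrite card_eq_le => /andP[].
Qed.

(** Among the subsets of [T] that are upper bounds, one, [S], has least cardinality. An upper bound
    [mu] not already above [S] injects into [S], so it is equipotent to a subset of [T] that is
    again an upper bound, and minimality applies to that subset. *)
Lemma card_sup_exists (P : Type -> Prop) (T : Type) :
  (forall Gamma, P Gamma -> [set: Gamma] #<= [set: T]) ->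
  exists kappa, is_card_sup P kappa.
Proof.
move=> PT.
pose ub mu := forall Gamma, P Gamma -> [set: Gamma] #<= [set: mu].
have ubT : ub (set_type [set: T]).
  move=> Gamma /PT /card_le_trans; apply.
  by rewrite (card_le_eqr (card_setT _)).
have [[S ubS] Smin] := card_family_min
  (fun S : {S : set T | ub (set_type S)} => set_type (projT1 S))
  (exist (fun S : set T => ub (set_type S)) [set: T] ubT).
exists (set_type S); split=> // mu ubmu.
(* The two-member family indexed by [bool] makes the cardinals of [mu] and [S] comparable. *)
have [b bmin] :=
  card_family_min (fun b : bool => if b then mu else set_type S) true.
case: b bmin => [/(_ false) muS|/(_ true)//].
have [f f_inj] : exists f : mu -> set_type S, injective f.
  have /card_leP[f] := muS.
  exists (fun m => val (f (to_setT m))) => x y /val_inj /inj.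
  by rewrite !inE => /(_ I I) /(congr1 val).
pose g m := val (f m).
have g_inj : injective g by move=> x y /val_inj /f_inj.
have ubg : ub (set_type (range g)).
  move=> Gamma /ubmu /card_le_trans; apply.
  rewrite (card_le_eqr (card_setT _)) (card_le_eqr (inj_card_eq _))//.
  by move=> x y _ _; exact: g_inj.
apply: (card_le_trans (Smin (exist (fun S => ub (set_type S)) _ ubg))) => /=.
rewrite (card_le_eql (card_setT _)) (card_le_eql (inj_card_eq _))//.
by move=> x y _ _; exact: g_inj.
Qed.

End Cardinals.

(** * The perfect kernel as the largest subset dense in itself *)

Section PerfectKernel.
Context {S : topologicalType}.

(** The derivatives are constant from some [a] on, so those at the first and second successors of
    [a] agree. *)
Lemma derived_perfect_kernel : derived (perfect_kernel S) = perfect_kernel S.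
Proof.
have [a aP] := @perfect_kernelP S.
have le1 := ord_le_succ a.
by rewrite -{1}(aP _ le1) -(aP _ (ord_le_trans le1 (ord_le_succ _))).
Qed.

(** By induction on the ordinal, no derivative loses a point of [A]: at successors because [derived]
    is monotone, at limits by intersection. *)
Lemma dense_in_itself_sub_perfect_kernel (A : set S) :
  A `<=` derived A -> A `<=` perfect_kernel S.
Proof.
move=> AdA; have [a aP] := @perfect_kernelP S.
rewrite -(aP _ (ord_le_succ a)); elim: (ord_succ a) => //=.
- by move=> b Ab; apply: subset_trans AdA _; exact: derivedS.
- by move=> I f Af x Ax i _; exact: Af.
Qed.

End PerfectKernel.

(** * Compactness and Cantor schemes *)

Lemma compact_directed_bigcap (T : topologicalType) (I : Type) (i0 : I)
    (F : I -> set T) : compact [set: T] ->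
  (forall i, closed (F i)) -> (forall i, F i !=set0) ->
  (forall i j, exists k, F k `<=` F i `&` F j) ->
  \bigcap_i F i !=set0.
Proof.
move=> cT clF neF dirF.
have FF : ProperFilter (filter_from setT F).
  apply: filter_from_proper => [|i _]; last exact: neF.
  apply: filter_from_filter; first by exists i0.
  by move=> i j _ _; have [k] := dirF i j; exists k.
have [x [_ clx]] := cT _ FF filterT.
exists x => i _; rewrite (closure_id (F i)).1//.
by move=> B nB; apply: clx nB; exists i.
Qed.

Section CantorScheme.
Context {K : topologicalType} (A : seq bool -> set K).
Hypotheses (K_compact : compact [set: K]) (A_closed : forall s, closed (A s))
  (A_nonempty : forall s, A s !=set0)
  (A_sub : forall b s, A (b :: s) `<=` A s)
  (A_disj : forall s, A (true :: s) `&` A (false :: s) = set0).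

Definition scheme_limit : set K :=
  \bigcap_n \bigcup_(s in [set s | size s = n]) A s.

(** Lists carry the latest choice at the head: [b :: s] is a child of the node [s]. Bit [n] is
    therefore the choice made on leaving a node of length [n]. *)
Definition scheme_address (x : K) : cantor_space :=
  fun n => `[< exists2 s, size s = n & A (true :: s) x >].

Let A_inj s t x : size s = size t -> A s x -> A t x -> s = t.
Proof.
elim: s t => [|b s IHs] [|c t]//= [st] As At.
have {IHs} e : s = t by apply: (IHs _ st); apply: A_sub; eassumption.
subst t; congr cons; have /seteqP[+ _] := A_disj s; move=> /(_ x).
by case: b c As At => -[] // As At; case; split.
Qed.

Let address b s x : A (b :: s) x -> scheme_address x (size s) = b.
Proof.
case: b => Ax; first by apply/asboolP; exists s.
apply/asboolP => -[t ts At].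
have := A_inj (s := false :: s) (t := true :: t) _ Ax At.
by move=> /(_ (congr1 S (esym ts))).
Qed.

Fixpoint address_prefix (f : cantor_space) n : seq bool :=
  if n is m.+1 then f m :: address_prefix f m else [::].

Let size_address_prefix f n : size (address_prefix f n) = n.
Proof. by elim: n => //= n ->. Qed.

Let finite_level n : finite_set [set s : seq bool | size s = n].
Proof.
rewrite (_ : mkset _ = [set val t | t in [set: n.-tuple bool]]).
  exact/finite_image/finite_finset.
apply/seteqP; split=> [s /= /eqP sn|_ [t _ <-]]; last exact: size_tuple.
by exists (Tuple sn).
Qed.

Lemma scheme_limit_closed : closed scheme_limit.
Proof.
apply: closed_bigI => n _; apply: closed_bigcup => //; exact: finite_level.
Qed.

Lemma scheme_limit_sub : scheme_limit `<=` A [::].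
Proof. by move=> x /(_ 0%N I)[s /size0nil ->]. Qed.

Lemma scheme_limitT :
  (forall s, A s `<=` A (true :: s) `|` A (false :: s)) ->
  scheme_limit = A [::].
Proof.
move=> Acov; apply/seteqP; split; first exact: scheme_limit_sub.
move=> x Ax n _; elim: n => [|n [s sn Asx]]; first by exists [::].
by have [?|?] := Acov s x Asx; [exists (true :: s)|exists (false :: s)];
  rewrite //= sn.
Qed.

Let limit_address_prefix x n :
  scheme_limit x -> A (address_prefix (scheme_address x) n) x.
Proof.
move=> Fx; elim: n => [|n IHn] /=; first exact: scheme_limit_sub.
have [[//|b s] /= [sn] Ax] := Fx n.+1 I.
have e : s = address_prefix (scheme_address x) n.
  by apply: (A_inj _ _ IHn); [rewrite sn size_address_prefix|apply: A_sub Ax].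
by rewrite -e -sn (address Ax).
Qed.

(** The sets along the branch [f] are closed, nonempty and decreasing, so compactness gives a common
    point, whose address is [f]. *)
Lemma scheme_address_surj : scheme_address @` scheme_limit = setT.
Proof.
apply/seteqP; split=> // f _.
have address_prefix_sub m n : (m <= n)%N ->
    A (address_prefix f n) `<=` A (address_prefix f m).
  elim: n => [|n IHn]; first by rewrite leqn0 => /eqP ->.
  rewrite leq_eqVlt ltnS => /predU1P[-> //|/IHn mn].
  by apply: subset_trans mn; exact: A_sub.
have [x fx] : \bigcap_n A (address_prefix f n) !=set0.
  apply: (compact_directed_bigcap 0%N) => // m n; exists (maxn m n) => x Ax.
  by split; apply: address_prefix_sub Ax; rewrite ?leq_maxl ?leq_maxr.
have Fx : scheme_limit x.
  move=> n _; exists (address_prefix f n); first exact: size_address_prefix.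
  exact: fx.
exists x => //; apply/funext => n.
by have := address (fx n.+1 I); rewrite size_address_prefix.
Qed.

(** Each bit is locally constant on the limit set: the pieces with the opposite bit at level [n]
    have a closed union [C], being finitely many, and [x] has a neighborhood avoiding it. *)
Lemma scheme_address_continuous :
  {within scheme_limit, continuous scheme_address}.
Proof.
apply/subspace_continuousP => x Fx.
apply/cvg_sup => n U [V] [[W] oW <-] Wx WU.
pose b := scheme_address x n.
pose C := \bigcup_(s in [set s | size s = n]) A (~~ b :: s).
have Cx : nbhs x (~` C).
  apply: open_nbhs_nbhs; split.
    apply: closed_openC; apply: closed_bigcup => [|s _]; last exact: A_closed.
    exact: finite_level.
  by move=> [s sn /address]; rewrite sn -/b; case: (b).
rewrite /= nbhs_simpl /within/=; apply: filterS Cx => y Cy Fy.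
have yn : scheme_address y n = b.
  apply/eqP/negPn/negP => /eqP nb; apply: Cy.
  exists (address_prefix (scheme_address y) n); first exact: size_address_prefix.
  suff <- : scheme_address y n = ~~ b by exact: (limit_address_prefix n.+1 Fy).
  by case: (scheme_address y n) (b) nb => -[].
apply: WU; move: Wx; rewrite /= /proj /= => Wx.
have : W (scheme_address y n) by rewrite yn.
exact.
Qed.

End CantorScheme.

(** * Cantor images inside open sets that meet the perfect kernel *)

Definition scheme_of (K : Type) (B : set K -> bool -> set K) (V : set K) :
    seq bool -> set K :=
  foldr (fun b W => B W b) V.

Section PerfectScheme.
Context {K : topologicalType}.
Hypotheses (K_compact : compact [set: K]) (K_hausdorff : hausdorff_space K).
Local Notation P := (perfect_kernel K).

Let two_points (V : set K) : open V -> V `&` P !=set0 ->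
  exists x y : K, [/\ x != y, V x, V y, P x & P y].
Proof.
move=> oV [x [Vx Px]].
have [_ lx] : derived P x by rewrite derived_perfect_kernel.
have [y [yx Py Vy]] := lx V (open_nbhs_nbhs (conj oV Vx)).
by exists x, y; rewrite eq_sym.
Qed.

(* A closed set stands for its interior, which is the open set being split. *)
Lemma perfect_cantor_image (V : set K) : open V -> V `&` P !=set0 ->
  exists F (phi : K -> cantor_space),
    [/\ closed F, F `<=` V, {within F, continuous phi} & phi @` F = setT].
Proof.
move=> oV VP.
pose Q (A : set K) := closed A /\ A° `&` P !=set0.
have shrink (W : set K) x : nbhs x W -> P x -> exists A, Q A /\ A `<=` W.
  move=> nW Px.
  have [N nN NW] :=
    compact_regular K_hausdorff K_compact (filterT : nbhs x _) nW.
  exists (closure N); split=> //; split; first exact: closed_closure.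
  by exists x; split=> //; apply: filterS nN; exact: subset_closure.
have split_ex A : exists B : bool -> set K, Q A ->
    (forall b, Q (B b) /\ B b `<=` A) /\ B true `&` B false = set0.
  (* Sets outside [Q] get a dummy splitting, so that a splitting can be chosen for every set at
     once. *)
  have [QA|nQA] := pselect (Q A); last by exists (fun=> A).
  have [x [y [xy Ax Ay Px Py]]] := two_points (open_interior A) QA.2.
  have [[X Y] /= [/set_mem Xx /set_mem Yy] [oX oY /eqP XY]] :
    exists2 AB : set K * set K, (x \in AB.1 /\ y \in AB.2) &
      [/\ open AB.1, open AB.2 & AB.1 `&` AB.2 == set0].
    by move: (K_hausdorff); rewrite open_hausdorff; apply.
  have [|B1 [QB1 B1A]] := shrink (X `&` A) x _ Px.
    by apply: filterI => //; exact: open_nbhs_nbhs.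
  have [|B0 [QB0 B0A]] := shrink (Y `&` A) y _ Py.
    by apply: filterI => //; exact: open_nbhs_nbhs.
  exists (fun b => if b then B1 else B0) => _; split.
    by case; split=> // z; [case/B1A|case/B0A].
  by apply/seteqP; split=> // z [/B1A[Xz _] /B0A[Yz _]]; rewrite -XY; split.
have [B BP] := choice split_ex.
have [x [Vx Px]] := VP.
have [A [QA AV]] := shrink V x (open_nbhs_nbhs (conj oV Vx)) Px.
pose A_ := scheme_of B A.
have QA_ s : Q (A_ s) by elim: s => //= b s /BP[+ _]; case/(_ b).
have A_closed s : closed (A_ s) by case: (QA_ s).
have A_neq0 s : A_ s !=set0.
  by have [_ [z [/interior_subset Az _]]] := QA_ s; exists z.
have A_sub b s : A_ (b :: s) `<=` A_ s by have [/(_ b)[]] := BP _ (QA_ s).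
have A_disj s : A_ (true :: s) `&` A_ (false :: s) = set0.
  by have [] := BP _ (QA_ s).
exists (scheme_limit A_), (scheme_address A_); split.
- exact: scheme_limit_closed.
- by apply: subset_trans AV; exact: scheme_limit_sub.
- exact: scheme_address_continuous.
- exact: scheme_address_surj.
Qed.

(** Here a piece splits into two complementary clopen halves separating two kernel points. Since
    siblings cover their parent, [scheme_limitT] identifies the limit set with the initial clopen
    set, which makes the domain clopen. *)
Lemma perfect_clopen_cantor_image (V : set K) : has_clopen_base K ->
  open V -> V `&` P !=set0 ->
  exists F (phi : K -> cantor_space),
    [/\ clopen F, F `<=` V, {within F, continuous phi} & phi @` F = setT].
Proof.
move=> [base [base_open base_nbhs] base_clopen] oV VP.
pose Q (A : set K) := clopen A /\ A `&` P !=set0.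
have shrink (W : set K) x : nbhs x W -> exists A, [/\ clopen A, A x & A `<=` W].
  by move=> /base_nbhs[A [/base_clopen clA Ax] AW]; exists A.
have split_ex A : exists B : bool -> set K, Q A ->
    [/\ forall b, Q (B b) /\ B b `<=` A, B true `&` B false = set0
      & A `<=` B true `|` B false].
  have [QA|nQA] := pselect (Q A); last by exists (fun=> A).
  have [x [y [xy Ax Ay Px Py]]] := two_points QA.1.1 QA.2.
  have [|W [clW Wx Wy]] := shrink (~` [set y]) x.
    apply: open_nbhs_nbhs; split; last exact/eqP.
    exact/closed_openC/accessible_closed_set1/hausdorff_accessible.
  exists (fun b => if b then A `&` W else A `\` W) => _; split.
  - case; (split; last by move=> z []); split.
    + exact: clopenI QA.1 clW.
    + by exists x.
    + rewrite setDE; apply: clopenI; first exact: QA.1.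
      exact: (clopenC set0).
    + by exists y; split=> //=; split=> // /Wy; apply.
  - by apply/seteqP; split=> // z [[_ ?] []].
  - by move=> z Az; have [?|?] := pselect (W z); [left|right].
have [B BP] := choice split_ex.
have [x [Vx Px]] := VP.
have [A [clA Ax AV]] := shrink V x (open_nbhs_nbhs (conj oV Vx)).
have QA : Q A by split=> //; exists x.
pose A_ := scheme_of B A.
have QA_ s : Q (A_ s) by elim: s => //= b s /BP[+ _ _]; case/(_ b).
have A_closed s : closed (A_ s) by case: (QA_ s) => -[].
have A_neq0 s : A_ s !=set0 by have [_ [z [Az _]]] := QA_ s; exists z.
have A_sub b s : A_ (b :: s) `<=` A_ s by have [/(_ b)[]] := BP _ (QA_ s).
have A_disj s : A_ (true :: s) `&` A_ (false :: s) = set0.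
  by have [] := BP _ (QA_ s).
have A_cov : scheme_limit A_ = A.
  by apply: scheme_limitT => // s; have [] := BP _ (QA_ s).
exists (scheme_limit A_), (scheme_address A_); split.
- by rewrite A_cov.
- by rewrite A_cov.
- exact: scheme_address_continuous.
- exact: scheme_address_surj.
Qed.

End PerfectScheme.

Local Open Scope ring_scope.

(** * Subspaces and the unit interval *)

Lemma compact_set_type (T : topologicalType) (A : set T) :
  compact A -> compact [set: set_type A].
Proof.
move=> cA F FF _.
have [|x [Ax clx]] := cA ((set_val : set_type A -> T) @ F) _.
  by apply: (@filterS _ F _ setT) => [x _|]; [exact: set_valP|exact: filterT].
exists (exist _ x (mem_set Ax)); split=> // B C FB [_ [[W oW <-] Wx] WC].
have FB' : F (set_val @^-1` (set_val @` B)).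
  by apply: filterS FB => z Bz; exists z.
have [_ [[z Bz <-] Wz]] :=
  clx (set_val @` B) W FB' (open_nbhs_nbhs (conj oW Wx)).
by exists z; split=> //; exact: WC.
Qed.

Lemma hausdorff_set_type (T : topologicalType) (A : set T) :
  hausdorff_space T -> hausdorff_space (set_type A).
Proof.
move=> hT x y xy; apply: val_inj; apply: hT => B C nB nC.
have [z [Bz Cz]] := xy _ _ (initial_continuous nB) (initial_continuous nC).
by exists (val z).
Qed.

Section UnitInterval.
Context {R : realType}.
Local Notation I01 := (set_type (`[0, 1]%classic : set R)).

Let zero_in : (0 : R) \in (`[0, 1]%classic : set R).
Proof. by rewrite inE /= in_itv /= lexx ler01. Qed.

HB.instance Definition _ := isPointed.Build I01 (exist _ 0 zero_in).

Lemma unit_interval_compact : compact [set: unit_interval R].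
Proof. exact/compact_set_type/segment_compact. Qed.

Lemma unit_interval_hausdorff : hausdorff_space (unit_interval R).
Proof. exact/hausdorff_set_type/Rhausdorff. Qed.

Lemma cantor_onto_unit_interval :
  exists2 e : cantor_space -> unit_interval R, continuous e & range e = setT.
Proof.
have [e ce] := @cantor_surj R I01 unit_interval_compact unit_interval_hausdorff.
exists e => //; apply/seteqP; split=> // x _.
by have [y _ <-] := 'surj_e (I : [set: I01] x); exists y.
Qed.

Lemma unit_interval_perfect : perfect_set [set: unit_interval R].
Proof.
split; first exact: closedT.
apply/seteqP; split=> // x _ U [_ [[W oW <-] Wx] WU].
have /nbhs_ballP[e /= e0 eW] : nbhs (val x) W by exact: open_nbhs_nbhs.
pose t : R := val x.
have /andP[x0 x1] : 0 <= t <= 1 by have := set_valP x; rewrite /= in_itv.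
(* The new point [y] moves from [t] by [d] towards the farther endpoint: [d <= 1 / 2] keeps it in
   the interval and [d <= e / 2] keeps it in the ball. *)
pose d : R := Num.min (e / 2) (1 / 2).
have de : d <= e / 2 by rewrite ge_min lexx.
have d1 : d <= 1 / 2 by rewrite ge_min lexx orbT.
have d0 : 0 < d by rewrite lt_min !divr_gt0.
pose y : R := if t <= 1 / 2 then t + d else t - d.
have y01 : y \in (`[0, 1]%classic : set R).
  rewrite inE /= in_itv /= /y.
  by case: (leP t (1 / 2)) => x2; apply/andP; split; lra.
pose x' : unit_interval R := exist _ y y01.
exists x'; split=> //.
  apply/eqP => /(congr1 val); rewrite -/t /= /y; case: ifP => _; lra.
apply: WU; apply: eW; change (`|t - y| < e); rewrite ltr_norml /y.
by case: ifP => _; apply/andP; split; lra.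
Qed.

End UnitInterval.

(** * Bump functions over the perfect kernel *)

Section Bump.
Context {R : realType} {K : topologicalType}.
Hypotheses (K_compact : compact [set: K]) (K_hausdorff : hausdorff_space K).

Let K_normal : normal_space K := compact_normal K_hausdorff K_compact.

(** A single Tietze extension [g] yields both functions: it maps a closed subset of [V] onto [0,1]
    and vanishes off [V]. The lower half of the range of [|g|] drives [u] from 0 to 1; the upper
    half, where [u] is already 1, drives [h] across [0,1]. *)
Lemma perfect_kernel_bump (V : set K) :
  open V -> V `&` perfect_kernel K !=set0 ->
  exists (u : K -> R) (h : K -> unit_interval R),
    [/\ continuous u, continuous h, forall x, 0 <= u x <= 1,
      forall x, ~ V x -> u x = 0 & forall l, exists2 x, u x = 1 & h x = l].
Proof.
move=> oV VP.
have [F [phi [clF FV cphi phiF]]] :=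
  perfect_cantor_image K_compact K_hausdorff oV VP.
have [e ce eT] := @cantor_onto_unit_interval R.
pose f0 x : R := if x \in F then val (e (phi x)) else 0.
(* [F] and the complement of [V] are disjoint closed sets, so continuity is checked on each
   separately. *)
have cf0 : {within F `|` ~` V, continuous f0}.
  apply: withinU_continuous => //; first exact: open_closedC.
    apply: (@subspace_eq_continuous _ _ _ (fun x => val (e (phi x)))).
      by move=> x xF; rewrite /from_subspace /f0 ifT.
    apply: (@within_continuous_comp _ _ _ F phi (fun z => val (e z))) => //.
    move=> z _; apply: continuous_comp; first exact: ce.
    exact: initial_continuous.
  apply: (@subspace_eq_continuous _ _ _ (fun=> 0)).
    move=> x /set_mem Vx; rewrite /from_subspace /f0.
    case: ifP => // /set_mem /FV.
    by move/Vx.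
  exact/continuous_subspaceT/cst_continuous.
have f01 x : 0 <= f0 x <= 1.
  rewrite /f0; case: ifP => _; last by rewrite lexx ler01.
  by have := valP (e (phi x)); rewrite inE /= in_itv.
have [|g [gf0 cg g1]] := @continuous_bounded_extension _ _ K_normal _
    (closedU clF (open_closedC oV)) f0 1 ltr01 cf0.
  by move=> x _; have /andP[f00 f0_1] := f01 x; rewrite ger0_norm.
have cng : continuous (fun x => `|g x|).
  by move=> x; apply: continuous_comp; [exact: cg|exact: norm_continuous].
have gV x : ~ V x -> g x = 0.
  move=> Vx; rewrite -gf0; last by rewrite inE; right.
  by rewrite /f0 /= ifF//; apply/negbTE/negP => /set_mem /FV.
pose clamp (y : R) := Num.max 0 (2 * y - 1).
have h01 x : clamp `|g x| \in (`[0, 1]%classic : set R).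
  rewrite inE /= in_itv /= /clamp le_max lexx /= ge_max ler01 /=.
  have := g1 x; lra.
pose h x : unit_interval R := exist _ (clamp `|g x|) (h01 x).
have cscale2 : continuous (fun x => 2 * `|g x|).
  move=> x; apply: (@continuousM R K (fun=> 2) (fun x => `|g x|)).
    exact: cvg_cst.
  exact: cng.
exists (fun x => Num.min 1 (2 * `|g x|)), h; split.
- move=> x; apply: (@continuous_min R K (fun=> 1) (fun x => 2 * `|g x|)).
  + exact: cvg_cst.
  + exact: cscale2.
- apply: continuous_comp_initial => x.
  apply: (@continuous_max R K (fun=> 0) (fun x => 2 * `|g x| - 1)).
    exact: cvg_cst.
  by apply: (@continuousB R R^o); [exact: cscale2|exact: cvg_cst].
- by move=> x; rewrite le_min ler01 mulr_ge0//= ge_min lexx.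
- by move=> x /gV ->; rewrite normr0 mulr0; apply/min_idPr.
move=> l; pose t : R := val l.
have /andP[t0 t1] : 0 <= t <= 1 by have := set_valP l; rewrite /= in_itv.
(* This is the value of [|g|] that [clamp] sends to [t]; it is at least 1/2, which forces [u] to be
   1 there. *)
have s01 : (t + 1) / 2 \in (`[0, 1]%classic : set R).
  by rewrite inE /= in_itv /=; apply/andP; split; lra.
have [z _ ez] : range e (exist _ ((t + 1) / 2) s01) by rewrite eT.
have [x Fx phix] : (phi @` F) z by rewrite phiF.
have gx : `|g x| = (t + 1) / 2.
  rewrite -gf0; last by rewrite inE; left.
  rewrite /f0 ifT ?inE// phix ez /= ger0_norm//; lra.
exists x; first by rewrite gx; apply/min_idPl; lra.
apply: val_inj; rewrite /= /clamp gx -/t.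
have -> : 2 * ((t + 1) / 2) - 1 = t by lra.
exact/max_idPr.
Qed.

End Bump.

(* The point [d] is the point at infinity when [Gamma] is infinite, and any
   point at all when [Gamma] is finite. *)
Record copies_of (Gamma : Type) (L X : topologicalType)
    (i : Gamma -> L -> X) (d : X) : Prop := CopiesOf {
  copy_continuous : forall c, continuous (i c);
  copy_open : forall c A, open A -> open (i c @` A);
  copy_inj : forall c c' l l', i c l = i c' l' -> c = c' /\ l = l';
  copy_cover : forall x, x = d \/ exists c l, x = i c l;
  copy_nbhs : forall V, nbhs d V -> finite_set [set c | ~ range (i c) `<=` V];
  copy_dense : forall V, nbhs d V -> exists c l, V (i c l) }.

(** * Topology of the spaces of copies *)

Section CopiesSpace.
Context {Gamma : Type} {L : topologicalType}.
Hypotheses (L_compact : compact [set: L]) (L_hausdorff : hausdorff_space L).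
Local Notation X := {_ : {classic Gamma} & L}.

Let copy (c : Gamma) (l : L) : X := existT (fun=> L) (c : {classic Gamma}) l.

Let copy_injective c c' l l' : copy c l = copy c' l' -> c = c' /\ l = l'.
Proof.
move=> e; split; first exact: (congr1 tag e).
exact: (congr1 (fun x : X => projT2 x) e).
Qed.

Let sum_locally_compact : locally_compact [set: X].
Proof.
move=> [c l] _.
have cpt : compact (range (copy c)).
  apply: continuous_compact L_compact.
  exact/continuous_subspaceT/existT_continuous.
exists (range (copy c)).
  have nc : nbhs (copy c l) (range (copy c)).
    by apply: existT_nbhs; exact: filterT.
  by rewrite /within/=; apply: filterS nc.
by split=> //; apply: compact_closed => //; exact: sigT_hausdorff.
Qed.

(** The copies form a disjoint open cover, so a finite subcover of [W] lists every copy that [W]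
    meets. *)
Let compact_meets_finite (x0 : X) (W : set X) :
  compact W -> finite_set [set c : Gamma | exists l, W (copy c l)].
Proof.
pose Xp : ptopologicalType :=
  HB.pack_for ptopologicalType X (isPointed.Build X x0).
rewrite [compact W](congr1 (fun P => P W) (@compact_cover Xp)).
move=> /(_ {classic Gamma} setT (fun c => range (copy c))).
case=> [c _|[c l] _|D _ WD].
- exact: existT_open_map openT.
- by exists c => //; exists l.
apply: (sub_finite_set _ (finite_fset D)) => c [l /WD[c' Dc' [l' _]]].
by move=> /copy_injective[<-].
Qed.

Lemma copies_spaceP : [set: Gamma] !=set0 -> [set: L] !=set0 ->
  [/\ compact [set: copies_space Gamma L],
      hausdorff_space (copies_space Gamma L)
    & exists i d, @copies_of Gamma L (copies_space Gamma L) i d].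
Proof.
move=> [c0 _] [l0 _]; rewrite /copies_space; case: pselect => finG.
  split; [exact: sigT_compact|exact: sigT_hausdorff|].
  exists copy, (copy c0 l0); split.
  - by move=> c; exact: existT_continuous.
  - by move=> c A; exact: existT_open_map.
  - exact: copy_injective.
  - by case=> c l; right; exists c, l.
  - by move=> V _; exact: (sub_finite_set (@subsetT _ _) finG).
  - by move=> V /nbhs_singleton; exists c0, l0.
split; [exact: one_point_compactification_compact|
  by apply: one_point_compactification_hausdorff; last exact: sigT_hausdorff|].
have fin V : nbhs (None : one_point_compactification X) V ->
    finite_set [set c | ~ range (fun l => Some (copy c l)) `<=` V].
  move=> [W [cW _] WV].
  apply: sub_finite_set (compact_meets_finite (copy c0 l0) cW) => c cV.
  apply: contrapT => cW'; apply: cV => _ [l _ <-].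
  by apply: WV; left; exists (copy c l) => // Wcl; apply: cW'; exists l.
exists (fun c l => Some (copy c l)), None; split.
- move=> c x; apply: continuous_comp; first exact: existT_continuous.
  exact: one_point_compactification_some_continuous.
- move=> c A oA; rewrite -[image _ _](image_comp (copy c) Some).
  by apply: one_point_compactification_open_some; exact: existT_open_map.
- by move=> c c' l l' /Some_inj /copy_injective.
- by case=> [[c l]|]; [right; exists c, l|left].
- exact: fin.
- move=> V /[dup] nV /fin finV.
  (* Only finitely many copies leave [V] while [Gamma] is infinite, so some whole copy lies in
     [V]. *)
  have /existsNP[c cV] : ~ forall c, ~ range (fun l => Some (copy c l)) `<=` V.
    by move=> allV; apply: (finG (sub_finite_set _ finV)) => c _; exact: allV.
  by exists c, l0; apply: (contrapT cV); exists l0.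
Qed.

End CopiesSpace.

(** * The supremum norm and linear operators *)

Section SupNorm.
Context {R : realType} {K : topologicalType}.
Implicit Type f : Cspace R K.

Let norm_continuous f : continuous (fun x => `|f x|).
Proof.
by move=> x; apply: continuous_comp; [exact: cts_fun|exact: norm_continuous].
Qed.

Lemma csupnorm_attained f : compact [set: K] -> [set: K] !=set0 ->
  exists x, csupnorm f = `|f x|.
Proof.
move=> cK K0.
have cf : {within [set: K], continuous (fun x => `|f x|)}.
  exact/continuous_subspaceT/norm_continuous.
have [x _ xmax] := compact_EVT_max K0 cK cf.
exists x; apply/eqP; rewrite eq_le; apply/andP; split.
  apply: ge_sup; first by exists `|f x|, x.
  by move=> _ [y _ <-]; apply: xmax; rewrite inE.
apply: ub_le_sup; last by exists x.
by exists `|f x| => _ [y _ <-]; apply: xmax; rewrite inE.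
Qed.

Lemma csupnorm_ge f x : compact [set: K] -> `|f x| <= csupnorm f.
Proof.
move=> cK; apply: ub_le_sup; last by exists x.
have cf : {within [set: K], continuous (fun x => `|f x|)}.
  exact/continuous_subspaceT/norm_continuous.
have [|y _ ymax] := compact_EVT_max _ cK cf; first by exists x.
by exists `|f y| => _ [z _ <-]; apply: ymax; rewrite inE.
Qed.

Lemma csupnorm_le f M : [set: K] !=set0 -> (forall x, `|f x| <= M) ->
  csupnorm f <= M.
Proof.
by move=> [x _] fM; apply: ge_sup; [exists `|f x|, x|move=> _ [y _ <-]].
Qed.

End SupNorm.

Lemma cspaceE (R : realType) (K : topologicalType) (f g : Cspace R K) :
  f =1 g -> f = g.
Proof. by move=> fg; apply/continuousEP. Qed.

Lemma linear_operator (R : realType) (L K : topologicalType)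
    (T : Cspace R L -> Cspace R K) :
  (forall a f g, T (a *: f + g) = a *: T f + T g) ->
  exists T' : {linear Cspace R L -> Cspace R K}, forall f, T' f = T f.
Proof.
move=> Tlin.
pose T' : {linear Cspace R L -> Cspace R K} :=
  HB.pack T (GRing.isLinear.Build R (Cspace R L) (Cspace R K) *:%R T Tlin).
by exists T'.
Qed.

(** * Gluing maps along disjoint cells *)

Section Cells.
Context {Gamma : Type} {K : topologicalType} (U : Gamma -> set K).
Hypothesis U_disj : forall c c' x, U c x -> U c' x -> c = c'.

Definition cell (x : K) : option Gamma :=
  if pselect (exists c, U c x) is left e then Some (projT1 (cid e)) else None.

Lemma cellE c x : U c x -> cell x = Some c.
Proof.
move=> Ux; rewrite /cell; case: pselect => [e|[]]; last by exists c.
by congr Some; apply: U_disj Ux; exact: projT2 (cid e).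
Qed.

Lemma cellP x :
  (exists2 c, U c x & cell x = Some c) \/
  ((forall c, ~ U c x) /\ cell x = None).
Proof.
have [[c Ux]|nU] := pselect (exists c, U c x).
  by left; exists c => //; exact: cellE.
right; split; first by apply/forallNP.
by rewrite /cell; case: pselect.
Qed.

End Cells.

Lemma near_finite (T : Type) (J : Type) (G : set J) (P : J -> set T)
    (F : set_system T) : Filter F ->
  finite_set G -> (forall j, G j -> F (P j)) -> F (\bigcap_(j in G) P j).
Proof.
move=> FF; elim/Pchoice: J => J in G P *.
move=> /finite_fsetP[D ->] FP; apply: filter_bigI => j jD; exact: FP.
Qed.

Section Copies.
Context {R : realType} {Gamma : Type} {L X K : topologicalType}.
Context (i : Gamma -> L -> X) (d : X).
Hypotheses (Xi : copies_of i d) (X_compact : compact [set: X]).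
Hypotheses (K_compact : compact [set: K]) (K_nonempty : [set: K] !=set0).
Context (U : Gamma -> set K).
Hypothesis U_disj : forall c c' x, U c x -> U c' x -> c = c'.

Section PositiveOperator.
Context (u : Gamma -> K -> R) (h : Gamma -> K -> L).
Hypotheses (U_open : forall c, open (U c)).
Hypotheses (u_cts : forall c, continuous (u c))
  (h_cts : forall c, continuous (h c)).
Hypotheses (u01 : forall c x, 0 <= u c x <= 1)
  (u_out : forall c x, ~ U c x -> u c x = 0)
  (uh_onto : forall c l, exists2 x, u c x = 1 & h c x = l).

Let bump (f : X -> R) c x := u c x * (f (i c (h c x)) - f d).

(** On [U c] this is the convex combination of [f d] and [f (i c (h c x))] with weight [u c x] on
    the latter; off the cells it is [f d]. *)
Let transfer (f : X -> R) x :=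
  f d + (if cell U x is Some c then bump f c x else 0).

(** The delicate points lie outside all cells, where infinitely many cells may accumulate. On all
    but finitely many copies [f] is within [e] of [f d], so those bumps are uniformly small; the
    remaining ones are continuous and vanish at the point. *)
Let transfer_continuous (f : Cspace R X) : continuous (transfer f).
Proof.
have cb c : continuous (bump f c).
  move=> x; apply: (@continuousM R K (u c)); first exact: u_cts.
  apply: (@continuousB R R^o); last exact: cvg_cst.
  apply: continuous_comp; last exact: cts_fun.
  by apply: continuous_comp; [exact: h_cts|exact: (copy_continuous Xi)].
move=> x; apply: (@continuousD R R^o K (fun=> f d)
  (fun x => if cell U x is Some c then bump f c x else 0)).
  exact: cvg_cst.
have [[c Ux cx]|[nUx cx]] := cellP U_disj x.
  apply/cvgrPdist_lt => e e0; rewrite cx.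
  have /cvgrPdist_lt/(_ e e0) near_b := cb c x.
  have near_U : nbhs x (U c) by exact: open_nbhs_nbhs.
  by apply: filterS2 near_b near_U => y ? /(cellE U_disj) ->.
apply/cvgrPdist_lt => e e0; rewrite cx.
have /(copy_nbhs Xi) finG : nbhs d [set y | `|f d - f y| < e].
  by have /cvgrPdist_lt/(_ e e0) := @cts_fun _ _ f d.
have near_b : nbhs x (\bigcap_(c in [set c | ~ range (i c) `<=`
    [set y | `|f d - f y| < e]]) [set y | `|bump f c y| < e]).
  apply: near_finite => // c _.
  have /cvgrPdist_lt/(_ e e0) := cb c x.
  by rewrite /bump u_out// mul0r; apply: filterS => y; rewrite /= sub0r normrN.
apply: filterS near_b => y near_b; rewrite sub0r normrN.
have [[c Uy ->]|[_ ->]] := cellP U_disj y; last by rewrite normr0.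
have [iV|niV] := pselect (range (i c) `<=` [set y | `|f d - f y| < e]).
  have /andP[u0 u1] := u01 c y.
  rewrite /bump normrM distrC (ger0_norm u0).
  apply: le_lt_trans (_ : `|f d - f (i c (h c y))| < e).
    exact: ler_piMl.
  by apply: iV; exists (h c y).
exact: near_b.
Qed.

(** Convex combinations give positivity and the bound by the norm of [f]. Conversely, each value of
    [f] on a copy is taken by [T f] at a point where [u c] is 1. *)
Lemma copies_embed_positively : embeds_positively_isometrically R X K.
Proof.
pose T0 (f : Cspace R X) : Cspace R K :=
  mkcts (@transfer_continuous f) : continuousType K R.
have [|T TE] := @linear_operator R X K T0.
  move=> a f g; apply: cspaceE => x.
  have -> : T0 (a *: f + g) x = transfer (fun y => a * f y + g y) x by [].
  have -> : (a *: T0 f + T0 g) x = a * transfer f x + transfer g x by [].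
  by rewrite /transfer /bump; case: cell => [c|]; lra.
have Ttr f x : T f x = transfer f x by rewrite TE.
have Tcell f c x : U c x ->
    T f x = (1 - u c x) * f d + u c x * f (i c (h c x)).
  move=> Ux; rewrite Ttr /transfer (cellE U_disj Ux) /bump; lra.
have Tout f x : (forall c, ~ U c x) -> T f x = f d.
  move=> nU; rewrite Ttr /transfer; have [[c /nU]//|[_ ->]] := cellP U_disj x.
  by rewrite addr0.
have T1 f c l : exists x, T f x = f (i c l).
  have [x ux hx] := uh_onto c l; exists x.
  rewrite (Tcell f c) ?ux ?hx; first lra.
  apply: contrapT => /u_out; rewrite ux; apply/eqP; exact: oner_neq0.
exists T => f; last first.
  move=> f0 x; have [[c Ux _]|[nU _]] := cellP U_disj x; last by rewrite Tout.
  have /andP[u0 u1] := u01 c x.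
  by rewrite (Tcell f c)// addr_ge0// mulr_ge0// subr_ge0.
apply/eqP; rewrite eq_le; apply/andP; split.
  apply: csupnorm_le => // x.
  have nd := csupnorm_ge f d X_compact.
  have [[c Ux _]|[nU _]] := cellP U_disj x; last by rewrite Tout.
  have /andP[u0 u1] := u01 c x.
  have nc := csupnorm_ge f (i c (h c x)) X_compact.
  rewrite (Tcell f c)//; apply: le_trans (ler_normD _ _) _.
  rewrite !normrM (ger0_norm u0) ger0_norm ?subr_ge0//.
  have : (1 - u c x) * `|f d| <= (1 - u c x) * csupnorm f.
    by apply: ler_wpM2l => //; rewrite subr_ge0.
  have : u c x * `|f (i c (h c x))| <= u c x * csupnorm f by exact: ler_wpM2l.
  lra.
have fcopy c l : `|f (i c l)| <= csupnorm (T f).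
  by have [x <-] := T1 f c l; exact: csupnorm_ge.
apply: csupnorm_le => [|x]; first by exists d.
have [->|[c [l ->]]] := copy_cover Xi x; last exact: fcopy.
(* The value at [d] is controlled by density: a larger [|f d|] would force a larger value at some
   point of a copy. *)
rewrite leNgt; apply/negP => lt_d.
have /(copy_dense Xi)[c [l]] : nbhs d [set y | csupnorm (T f) < `|f y|].
  have : {for d, continuous (fun y => `|f y|)}.
    by apply: continuous_comp; [exact: cts_fun|exact: norm_continuous].
  by move=> /(_ _ (lt_nbhsr lt_d)).
by rewrite /= ltNge fcopy.
Qed.

End PositiveOperator.

(** Continuity off the cells uses that only finitely many copies leave a neighborhood of [d], and
    their clopen cells can be avoided. The range is compact, hence closed, and contains every copy,
    so it also contains [d]. *)
Lemma copies_continuous_image (phi : Gamma -> K -> L) :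
  hausdorff_space X -> (forall c, clopen (U c)) ->
  (forall c, {within U c, continuous (phi c)}) ->
  (forall c, phi c @` U c = setT) ->
  maps_continuously_onto K X.
Proof.
move=> X_hausdorff clU phi_cts phi_onto.
pose Phi x := if cell U x is Some c then i c (phi c x) else d.
have cPhi : continuous Phi.
  move=> x V; have [[c Ux cx]|[nUx cx]] := cellP U_disj x.
    rewrite {1}/Phi cx => nV.
    have phi_x : {in U c, continuous (phi c)}.
      by rewrite -continuous_open_subspace//; case: (clU c).
    have near_V : nbhs x [set y | V (i c (phi c y))].
      exact: phi_x (mem_set Ux) _ (copy_continuous Xi nV).
    have near_U : nbhs x (U c).
      by apply: open_nbhs_nbhs; split=> //; case: (clU c).
    change (nbhs x (Phi @^-1` V)); apply: filterS2 near_V near_U => y /= ? Uy.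
    by rewrite /Phi (cellE U_disj Uy).
  rewrite {1}/Phi cx => nV; have finG := copy_nbhs Xi nV.
  have near_out : nbhs x (\bigcap_(c in [set c | ~ range (i c) `<=` V]) ~` U c).
    apply: near_finite => // c _; apply: open_nbhs_nbhs; split; last exact: nUx.
    exact/closed_openC/(clU c).2.
  change (nbhs x (Phi @^-1` V)); apply: filterS near_out => y nUy.
  rewrite /= /Phi.
  have [[c Uy ->]|[_ ->]] := cellP U_disj y; last exact: nbhs_singleton nV.
  apply: contrapT => nVy; apply: (nUy c) => // iV.
  by apply/nVy/iV; exists (phi c y).
exists Phi => //.
have fcopy c l : range Phi (i c l).
  have [x Ux <-] : (phi c @` U c) l by rewrite phi_onto.
  by exists x => //; rewrite /Phi (cellE U_disj Ux).
apply/seteqP; split=> // x _.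
have [->|[c [l ->]]] := copy_cover Xi x; last exact: fcopy.
apply: contrapT => nd.
have clPhi : closed (range Phi).
  apply: compact_closed => //; apply: continuous_compact K_compact.
  exact: continuous_subspaceT.
have /(copy_dense Xi)[c [l]] : nbhs d (~` range Phi).
  by apply: open_nbhs_nbhs; split => //; exact: closed_openC.
by apply; exact: fcopy.
Qed.

End Copies.

Lemma continuous_image_embeds (R : realType) (K X : topologicalType) :
  maps_continuously_onto K X ->
  embeds_lattice_algebraically_isometrically R X K.
Proof.
move=> [g cg gT].
have cfg (f : Cspace R X) : continuous (f \o g).
  by move=> x; apply: continuous_comp; [exact: cg|exact: cts_fun].
pose T0 (f : Cspace R X) : Cspace R K := mkcts (cfg f) : continuousType K R.
have [|T TE] := @linear_operator R X K T0.
  by move=> a f h; exact: cspaceE.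
exists T; split.
- move=> f; rewrite TE /csupnorm; congr sup; apply/seteqP; split.
    by move=> _ [x _ <-]; exists (g x).
  move=> _ [x _ <-]; have [y _ <-] : range g x by rewrite gT.
  by exists y.
- by split=> f h; rewrite !TE; exact: cspaceE.
- by move=> f h; rewrite !TE; exact: cspaceE.
Qed.

(** * Indicators of clopen sets *)

Section Indicator.
Context {R : realType} {X : topologicalType} (W : set X).
Hypothesis clW : clopen W.

Let indicator_continuous : continuous (fun x => if x \in W then 1 else 0 : R).
Proof.
move=> x; have [Wx|nWx] := pselect (W x).
  apply: cvg_near_cst; rewrite mem_set//.
  have : nbhs x W by apply: open_nbhs_nbhs; split=> //; case: clW.
  by apply: filterS => y Wy; rewrite mem_set.
apply: cvg_near_cst; rewrite memNset//.
have : nbhs x (~` W).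
  by apply: open_nbhs_nbhs; split=> //; apply: closed_openC; case: clW.
by apply: filterS => y nWy; rewrite memNset.
Qed.

Definition cindicator : Cspace R X :=
  mkcts indicator_continuous : continuousType X R.

Let cindicatorE x : cindicator x = if x \in W then 1 else 0.
Proof. by []. Qed.

Lemma cindicatorT x : W x -> cindicator x = 1.
Proof. by move=> Wx; rewrite cindicatorE mem_set. Qed.

Lemma cindicatorF x : ~ W x -> cindicator x = 0.
Proof. by move=> Wx; rewrite cindicatorE memNset. Qed.

Lemma cindicator01 x : 0 <= cindicator x <= 1.
Proof.
have [/cindicatorT ->|/cindicatorF ->] := pselect (W x);
  by rewrite ?lexx ?ler01.
Qed.

End Indicator.

(** * Isometric operators and the perfect kernel *)

Section IsometricOperator.
Context {R : realType} {X K : topologicalType}.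
Hypotheses (X_compact : compact [set: X]) (X_hausdorff : hausdorff_space X).
Hypotheses (K_compact : compact [set: K]) (K_nonempty : [set: K] !=set0).
Context (T : {linear Cspace R X -> Cspace R K}).
Hypothesis T_isometric : isometric_embedding T.

Let TP a f g y : T (a *: f + g) y = a * T f y + T g y.
Proof. by rewrite linearP. Qed.

Let T_le f y : `|T f y| <= csupnorm f.
Proof. by rewrite -T_isometric; exact: csupnorm_ge. Qed.

Let X_nonempty (x : X) : [set: X] !=set0.
Proof. by exists x. Qed.

(** Both [f + g] and [g - f] have norm at most 1, and with the right sign the image of one of them
    has absolute value [|T f y| + |T g y|] at [y]. *)
Lemma isometric_disjoint_le (f g : Cspace R X) (x0 : X) y :
  (forall x, 0 <= f x <= 1) -> (forall x, 0 <= g x <= 1) ->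
  (forall x, f x = 0 \/ g x = 0) -> `|T f y| + `|T g y| <= 1.
Proof.
move=> f01 g01 fg0.
have le1 (a : R) : `|a| <= 1 -> csupnorm (a *: f + g) <= 1.
  move=> a1; apply: csupnorm_le => [|x]; first exact: X_nonempty x0.
  have -> : (a *: f + g) x = a * f x + g x by [].
  have /andP[f0 f1] := f01 x; have /andP[g0 g1] := g01 x.
  have [->|->] := fg0 x; first by rewrite mulr0 add0r ger0_norm.
  by rewrite addr0 normrM (ger0_norm f0) -[leRHS]mulr1 ler_pM.
have Tle a : `|a| <= 1 -> `|a * T f y + T g y| <= 1.
  by move=> /le1; rewrite -TP; apply: le_trans; exact: T_le.
have := Tle 1; have := Tle (-1); rewrite normrN normr1 lexx.
move=> /(_ isT) h1 /(_ isT) h2; move: h1 h2; rewrite !ler_norml.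
have [?|?] := ger0P (T f y); have [?|?] := ger0P (T g y);
  move=> /andP[? ?] /andP[? ?]; lra.
Qed.

(** Take [y] in [E] where [T (a *: f + g)] attains its norm, which is at least [a * f t + 1].
    Bounding [|T g y|] by 1 gives the first estimate, bounding [|T f y|] by the norm of [f] gives
    the second. *)
Lemma norming_point (E : set K) (W : set X) (f g : Cspace R X) (a : R) (t : X) :
  (forall h : Cspace R X, (forall x, ~ W x -> h x = 0) ->
    exists2 y, E y & `|T h y| = csupnorm h) ->
  (forall x, ~ W x -> f x = 0) -> (forall x, ~ W x -> g x = 0) ->
  `|a| = 1 -> (forall x, 0 <= g x <= 1) -> g t = 1 ->
  exists y, [/\ E y, a * f t <= `|T f y|
    & a * f t + 1 <= csupnorm f + `|T g y|].
Proof.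
move=> Enorm fW gW a1 g01 gt.
have [|y Ey ny] := Enorm (a *: f + g).
  move=> x nWx; have -> : (a *: f + g) x = a * f x + g x by [].
  by rewrite fW// gW// mulr0 addr0.
exists y.
have : a * f t + 1 <= `|T (a *: f + g) y|.
  rewrite ny; apply: le_trans (csupnorm_ge _ t X_compact).
  have -> : (a *: f + g) t = a * f t + g t by [].
  by rewrite gt ler_norm.
rewrite TP => /le_trans /(_ (ler_normD _ _)); rewrite normrM a1 mul1r => le_sum.
have Tf1 := T_le f y.
have Tg1 : `|T g y| <= 1.
  apply: le_trans (T_le g y) _; apply: csupnorm_le => [|x].
    exact: X_nonempty t.
  by have /andP[g0 g1] := g01 x; rewrite ger0_norm.
by split=> //; lra.
Qed.

Section PerfectPiece.
Context (W : set X).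
Hypotheses (clW : clopen W) (W_nonempty : W !=set0).
Hypothesis W_perfect : forall O, open O -> O `<=` W -> O !=set0 ->
  exists t1 t2, [/\ t1 <> t2, O t1 & O t2].

Local Notation one := (cindicator (R := R) clW).
Local Notation supported f := (forall x, ~ W x -> f x = 0).

Let norming (E : set K) := forall f : Cspace R X, supported f ->
  exists2 y, E y & `|T f y| = csupnorm f.

Let T_closed (f : Cspace R X) (A : set R) : closed A ->
  closed [set y | A `|T f y|].
Proof.
move=> clA; have cT : continuous (fun y => `|T f y|).
  by move=> y; apply: continuous_comp; [exact: cts_fun|exact: norm_continuous].
by have /continuous_closedP := cT; apply.
Qed.

Let peak (f : Cspace R X) : supported f ->
  exists (a : R) t, [/\ `|a| = 1, W t & a * f t = csupnorm f].
Proof.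
move=> fW; have [w Ww] := W_nonempty.
have [x nx] := csupnorm_attained f X_compact (X_nonempty w).
have [t Wt nt] : exists2 t, W t & csupnorm f = `|f t|.
  have [Wx|nWx] := pselect (W x); first by exists x.
  exists w => //; apply/eqP; rewrite eq_le csupnorm_ge// nx fW// normr0.
  by rewrite normr_ge0.
rewrite nt; have [f0|f0] := ger0P (f t).
  by exists 1, t; rewrite normr1 mul1r.
by exists (-1), t; rewrite normrN normr1 mulN1r.
Qed.

Let one01 := cindicator01 (R := R) clW.

(** With [g] the indicator and [t] a peak of [f], the two estimates of [norming_point] make [|T f|]
    and [|T one|] maximal at the same point. *)
Let norming_one : norming [set y | `|T one y| = 1].
Proof.
move=> f fW; have [a [t [a1 Wt at_]]] := peak fW.
have normT : norming setT.
  move=> h _; have [y ny] := csupnorm_attained (T h) K_compact K_nonempty.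
  by exists y => //; rewrite -ny T_isometric.
have := @norming_point setT W f one a t.
case=> //; rewrite ?at_//.
- exact: cindicatorF.
- exact: cindicatorT.
move=> y [_ fy oney]; exists y; last first.
  by apply/eqP; rewrite eq_le fy T_le.
apply/eqP; rewrite eq_le /=; apply/andP; split; last lra.
apply: le_trans (T_le _ y) _; apply: csupnorm_le => [|x].
  exact: X_nonempty t.
by have /andP[g0 g1] := one01 x; rewrite ger0_norm.
Qed.

(* The complement of [O] in the peak set of [one] is a minimal closed norming
   set. *)
Let minimal_norming : exists O : set K,
  [/\ open O, norming ([set y | `|T one y| = 1] `\` O)
    & forall B, open B -> O `<` B ->
        ~ norming ([set y | `|T one y| = 1] `\` B)].
Proof.
set E1 := [set y | _].
have clE1 : closed E1.
  exact: (@T_closed one [set x | x = 1] (@closed_eq R 1)).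
pose P (O : set K) := open O /\ norming (E1 `\` O).
have [F FP Ftot|O [[oO nO] Omax]] := @Zorn_bigcup _ P; last first.
  by exists O; split=> // B oB OB nB; apply: (Omax B OB).
split; first by apply: bigcup_open => O /FP[].
(* The empty chain has empty union and reduces to [norming_one]. For a nonempty chain, the points
   where [|T f|] is maximal form directed nonempty closed sets, and compactness gives a common
   one. *)
move=> f fW; have [F0|F0] := pselect (F !=set0); last first.
  have [y E1y ny] := norming_one fW; exists y => //; split=> //.
  by move=> [ O FO _]; apply: F0; exists O.
have [ O0 FO0] := F0.
have [y Gy] : \bigcap_(O : {O | F O})
    ((E1 `\` projT1 O) `&` [set y | `|T f y| = csupnorm f]) !=set0.
  apply: (compact_directed_bigcap (exist _ O0 FO0)) => //.
  - move=> [ O FO] /=; apply: closedI.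
      rewrite setDE; apply: closedI => //; apply: open_closedC.
      by case: (FP _ FO).
    by exact: (@T_closed f [set x | x = csupnorm f] (@closed_eq R _)).
  - by move=> [ O FO] /=; have [_ /(_ f fW)[y Ey ny]] := FP _ FO; exists y.
  - move=> [ O FO] [ O' FO']; have [OO'|OO'] := Ftot _ _ FO FO'.
      exists (exist _ O' FO') => z /= [[E1z nO'z] nz]; split; split=> //.
      by split=> // /OO'.
    exists (exist _ O FO) => z /= [[E1z nOz] nz]; split; split=> //.
    by split=> // /OO'.
exists y; last by case: (Gy (exist _ O0 FO0) I).
split; first by case: (Gy (exist _ O0 FO0) I) => -[].
by move=> [ O FO Oy]; case: (Gy (exist _ O FO) I) => -[_ /=].
Qed.

Let bumps (O : set X) : open O -> O `<=` W -> O !=set0 ->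
  exists (g1 g2 : Cspace R X) t1 t2,
    [/\ O t1 /\ O t2, g1 t1 = 1 /\ g2 t2 = 1,
        (forall x, 0 <= g1 x <= 1) /\ (forall x, 0 <= g2 x <= 1),
        forall x, g1 x = 0 \/ g2 x = 0 & supported g1 /\ supported g2].
Proof.
move=> oO OW O0; have [t1 [t2 [t12 Ot1 Ot2]]] := W_perfect oO OW O0.
have bump A t : open A -> A t -> exists g : Cspace R X,
    [/\ forall x, 0 <= g x <= 1, g t = 1 & forall x, ~ A x -> g x = 0].
  move=> oA At.
  have clt : closed [set t].
    exact/accessible_closed_set1/hausdorff_accessible.
  have [|g [cg g0 g1 g01]] := @urysohn_ext_itv X R
    (compact_normal X_hausdorff X_compact) (~` A) [set t] 0 1
    (open_closedC oA) clt _ ltr01.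
    by apply/seteqP; split=> // z [/= + zt]; rewrite zt.
  exists (mkcts cg : continuousType X R); split.
  - by move=> x; have := g01 (g x); rewrite /= in_itv /=; apply; exists x.
  - by apply: g1; exists t.
  - by move=> x nAx; apply: g0; exists x.
have [[A1 A2] /= [/set_mem A1t /set_mem A2t] [oA1 oA2 /eqP A12]] :
  exists2 AB : set X * set X, (t1 \in AB.1 /\ t2 \in AB.2) &
    [/\ open AB.1, open AB.2 & AB.1 `&` AB.2 == set0].
  by move: (X_hausdorff); rewrite open_hausdorff; apply; exact/eqP.
have [g1 [g101 g1t g1A]] := bump (A1 `&` O) t1 (openI oA1 oO) (conj A1t Ot1).
have [g2 [g201 g2t g2A]] := bump (A2 `&` O) t2 (openI oA2 oO) (conj A2t Ot2).
exists g1, g2, t1, t2; split=> //.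
- move=> x; have [[A1x _]|/g1A] := pselect ((A1 `&` O) x); last by left.
  right; apply: g2A => -[A2x _].
  by have : (A1 `&` A2) x by []; rewrite A12.
- by split=> x nWx; [apply: g1A|apply: g2A] => -[_ /OW].
Qed.

Lemma isometric_meets_perfect_kernel :
  exists2 y, perfect_kernel K y & `|T one y| = 1.
Proof.
have [ O [oO nO Omin]] := minimal_norming.
set E := _ `\` O in nO.
have one_supp : supported one by exact: cindicatorF.
(* The indicator is itself supported by [W], so [E] is nonempty. *)
have [y0 Ey0 _] := nO one one_supp.
exists y0; last by case: Ey0.
apply: (@dense_in_itself_sub_perfect_kernel _ E) y0 Ey0 => x Ex.
split=> //; apply: contrapT => nlx.
have [U [oU Ux EU]] : exists U : set K,
    [/\ open U, U x & forall y, E y -> U y -> y = x].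
  move: nlx; rewrite not_limit_pointE => -[U].
  rewrite nbhsE => -[V [oV Vx] VU] EUx; exists V; split=> // y Ey Vy.
  by apply: EUx; split=> //; exact: VU.
(* Adding [U] enlarges [O] strictly, since [x] lies in [E]; minimality gives a supported [f] whose
   norm is not attained on [E] outside [U]. *)
have /existsNP[f /not_implyP[fW nf]] :
    ~ norming ([set y | `|T one y| = 1] `\` (O `|` U)).
  apply: Omin; first exact: openU.
  by split; [left|move=> /(_ x (or_intror Ux)); case: Ex].
have clE : closed ([set y | `|T one y| = 1] `\` (O `|` U)).
  rewrite setDE; apply: closedI; last exact/open_closedC/openU.
  exact: (@T_closed one [set x | x = 1] (@closed_eq R 1)).
(* [eta] is the maximum of [|T f|] over the compact remainder of [E]; if that remainder is empty,
   any number below the norm will do. *)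
have [eta eta_lt Tf_le] : exists2 eta, eta < csupnorm f &
    forall y, E y -> ~ U y -> `|T f y| <= eta.
  have [E0|nE0] := pselect ([set y | `|T one y| = 1] `\` (O `|` U) !=set0).
    have cE := subclosed_compact clE K_compact (@subsetT _ _).
    have cTf : {within [set y | `|T one y| = 1] `\` (O `|` U),
        continuous (fun y => `|T f y|)}.
      apply: continuous_subspaceT => y.
      by apply: continuous_comp; [exact: cts_fun|exact: norm_continuous].
    have [y /set_mem Ey ymax] := compact_EVT_max E0 cE cTf.
    exists `|T f y|.
      rewrite lt_neqAle T_le andbT; apply/eqP => ny.
      by apply: nf; exists y.
    move=> z [Ez nOz] nUz; apply: ymax; rewrite inE; split=> //.
    by move=> [/nOz|/nUz].
  exists (csupnorm f - 1); first lra.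
  move=> z [Ez nOz] nUz; exfalso; apply: nE0; exists z; split=> //.
  by move=> [/nOz|/nUz].
have [a [t [a1 Wt at_]]] := peak fW.
(* The first bound makes a value of [|T f|] above [csupnorm f - delta] on [E] possible only at [x];
   the second leaves more than 1/2 for [|T g x|]. *)
pose delta := Num.min (csupnorm f - eta) (1 / 2).
have delta0 : 0 < delta by rewrite lt_min subr_gt0 eta_lt divr_gt0.
have deltaf : delta <= csupnorm f - eta by rewrite ge_min lexx.
have delta1 : delta <= 1 / 2 by rewrite ge_min lexx orbT.
pose O1 := W `&` [set z | csupnorm f - delta < a * f z].
have [|||g1 [g2 [t1 [t2
  [[ O1t1 O1t2] [g1t g2t] [g101 g201] g12 [g1W g2W]]]]]] := @bumps O1.
- apply: openI; first by case: clW.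
  apply: (@open_comp X R (fun z => a * f z) [set r | csupnorm f - delta < r]).
    move=> z _; apply: (@continuousM R X (fun=> a) f); first exact: cvg_cst.
    exact: cts_fun.
  exact: open_gt.
- by move=> z [].
- by exists t; split=> //=; rewrite at_; lra.
have bump_at_x (g : Cspace R X) t' : supported g -> O1 t' -> g t' = 1 ->
    (forall z, 0 <= g z <= 1) -> 1 / 2 < `|T g x|.
  move=> gW [Wt' ft'] gt' g01.
  have [y [Ey fy gy]] := norming_point nO fW gW a1 g01 gt'.
  have [Uy|nUy] := pselect (U y).
    by rewrite -(EU y)//; move: ft' => /=; lra.
  have := Tf_le y Ey nUy; move: ft' => /=; lra.
have := isometric_disjoint_le t x g101 g201 g12.
have := bump_at_x _ _ g1W O1t1 g1t g101.
have := bump_at_x _ _ g2W O1t2 g2t g201.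
lra.
Qed.

End PerfectPiece.
End IsometricOperator.

(** * Cellular families and comparison of the suprema *)

Lemma isometric_embedding_cellular (R : realType) (Gamma : Type)
    (L X K : topologicalType) (i : Gamma -> L -> X) (d : X) :
  compact [set: L] -> perfect_set [set: L] -> [set: L] !=set0 ->
  copies_of i d -> compact [set: X] -> hausdorff_space X ->
  compact [set: K] -> [set: K] !=set0 ->
  embeds_isometrically R X K -> has_cellular_family (perfect_kernel K) Gamma.
Proof.
move=> cL [_ pL] [l0 _] Xi cX hX cK K0 [T Tiso].
have clW c : clopen (range (i c)).
  split; first exact: (copy_open Xi) openT.
  apply: compact_closed => //; apply: continuous_compact cL.
  exact/continuous_subspaceT/(copy_continuous Xi).
pose V c : set K := [set y | 1 / 2 < `|T (cindicator (clW c)) y|].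
have ePK c : exists2 y, perfect_kernel K y & V c y.
  (* An open subset of a copy pulls back to [L], where perfectness supplies the second point. *)
  have Wperfect (O : set X) : open O -> O `<=` range (i c) -> O !=set0 ->
      exists t1 t2, [/\ t1 <> t2, O t1 & O t2].
    move=> oO OW [x Ox].
    have [l _ il] := OW x Ox.
    have nl : nbhs l (i c @^-1` O).
      by apply: (copy_continuous Xi); rewrite il; exact: open_nbhs_nbhs.
    have : limit_point [set: L] l by rewrite pL.
    move=> /(_ _ nl)[l' [/eqP l'l _ Ol']].
    exists x, (i c l'); split=> //.
    by rewrite -il => /(copy_inj Xi)[_ /esym].
  have W0 : range (i c) !=set0 by exists (i c l0), l0.
  have [y PKy Ty] :=
    isometric_meets_perfect_kernel cX hX cK K0 Tiso (clW c) W0 Wperfect.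
  by exists y => //; rewrite /V /= Ty; lra.
have Vdisj c c' y : V c y -> V c' y -> c = c'.
  move=> Vy V'y; apply: contrapT => cc'.
  have disj x : cindicator (R := R) (clW c) x = 0 \/
      cindicator (R := R) (clW c') x = 0.
    have [[l _ <-]|nx] := pselect (range (i c) x); last first.
      by left; exact: cindicatorF.
    by right; apply: cindicatorF => -[l' _ /(copy_inj Xi)[/esym/cc']].
  have := isometric_disjoint_le cK Tiso (i c l0) y
    (cindicator01 (clW c)) (cindicator01 (clW c')) disj.
  move: Vy V'y; rewrite /V /=; lra.
exists (range V); split.
- split=> [_ [c _ <-]|].
    split; last by have [y _ Vy] := ePK c; exists y.
    apply: (@open_comp K R (fun y => `|T (cindicator (clW c)) y|)
      [set r | 1 / 2 < r]).
      move=> y _.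
      by apply: continuous_comp; [exact: cts_fun|exact: norm_continuous].
    exact: open_gt.
  by move=> _ _ [c _ <-] [c' _ <-] [y [/Vdisj Vy /Vy ->]].
- by move=> _ [c _ <-]; have [y ? ?] := ePK c; exists y.
- apply: inj_card_eq => c c' _ _ VV; have [y _ Vy] := ePK c.
  by apply: (Vdisj _ _ y) => //; rewrite -VV.
Qed.

Lemma cellular_enumeration (S : topologicalType) (A : set S) (Gamma : Type) :
  has_cellular_family A Gamma -> exists U : Gamma -> set S,
    [/\ forall c, open (U c), forall c, U c `&` A !=set0
      & forall c c' x, U c x -> U c' x -> c = c'].
Proof.
move=> [F [[Fopen Fdisj] FA FG]].
have /card_eqPle[_ /card_leP[g]] := FG.
exists (fun c => val (g (to_setT c))); split.
- by move=> c; have [] := Fopen _ (set_valP (g (to_setT c))).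
- by move=> c; rewrite setIC; apply: FA; exact: set_valP.
- move=> c c' x Ux U'x.
  have e : val (g (to_setT c)) = val (g (to_setT c')).
    by apply: Fdisj; [exact: set_valP|exact: set_valP|exists x].
  have : to_setT c = to_setT c'.
    by apply: 'inj_g; [rewrite inE|rewrite inE|exact: val_inj].
  by move=> /(congr1 val).
Qed.

(** An empty [Gamma] has cardinality 0 and constrains no upper bound, so agreement on nonempty types
    suffices. *)
Lemma card_sup_nonempty (P Q : Type -> Prop) (kappa : Type) :
  (forall Gamma, [set: Gamma] !=set0 -> P Gamma <-> Q Gamma) ->
  is_card_sup P kappa ->
  is_card_sup (fun Gamma => [set: Gamma] !=set0 /\ Q Gamma) kappa.
Proof.
move=> PQ [ub least]; split; first by move=> Gamma [G0 /PQ]; move/(_ G0)/ub.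
move=> mu ubQ; apply: least => Gamma PG.
have [G0|/set0P/negP/negPn/eqP ->] := pselect ([set: Gamma] !=set0).
  by apply: ubQ; split=> //; exact/PQ.
exact: card_ge0.
Qed.

Theorem theorem5p3 (R : realType) (K : topologicalType)
    (K_nonempty : [set: K] !=set0) (K_compact : compact [set: K])
    (K_hausdorff : hausdorff_space K) :
  exists kappa : Type,
    [/\ is_relative_cellularity (perfect_kernel K) kappa,
        is_card_sup (fun Gamma => [set: Gamma] !=set0 /\
          embeds_positively_isometrically R
            (copies_space Gamma (unit_interval R)) K) kappa,
        is_card_sup (fun Gamma => [set: Gamma] !=set0 /\
          embeds_isometrically R
            (copies_space Gamma (unit_interval R)) K) kappa
      & has_clopen_base K ->
        is_card_sup (fun Gamma => [set: Gamma] !=set0 /\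
          maps_continuously_onto K (copies_space Gamma cantor_space)) kappa /\
        is_card_sup (fun Gamma => [set: Gamma] !=set0 /\
          embeds_lattice_algebraically_isometrically R
            (copies_space Gamma cantor_space) K) kappa].
Proof.
(* A cellular family is a set of subsets of [K], so the power set bounds all the cardinals and the
   supremum exists. *)
have [|kappa supk] :=
  @card_sup_exists (has_cellular_family (perfect_kernel K)) (set K).
  move=> Gamma [F [_ _ FG]]; rewrite -(card_le_eql FG); exact: card_leT.
have cI := @unit_interval_compact R; have hI := @unit_interval_hausdorff R.
have cD := cantor_space_compact; have hD := cantor_space_hausdorff.
have D0 : [set: cantor_space] !=set0 by exists point.
have I0 : [set: unit_interval R] !=set0.
  by have [e _ _] := @cantor_onto_unit_interval R; exists (e point).
have pos_isom L : embeds_positively_isometrically R L K ->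
    embeds_isometrically R L K.
  by move=> [T Tiso _]; exists T.
have lat_isom L : embeds_lattice_algebraically_isometrically R L K ->
    embeds_isometrically R L K by move=> [T [Tiso _ _]]; exists T.
have cell_pos Gamma : [set: Gamma] !=set0 ->
    has_cellular_family (perfect_kernel K) Gamma ->
    embeds_positively_isometrically R (copies_space Gamma (unit_interval R)) K.
  move=> G0 /cellular_enumeration[U [oU UP Udisj]].
  have [cX _ [i [d Xi]]] := copies_spaceP cI hI G0 I0.
  have /choice[u /choice[h uhP]] c :=
    @perfect_kernel_bump R K K_compact K_hausdorff (U c) (oU c) (UP c).
  apply: (copies_embed_positively Xi cX K_compact K_nonempty Udisj
    (u := u) (h := h)) => // c;
    by case: (uhP c).
have isom_cell Gamma (L : topologicalType) :
    compact [set: L] -> hausdorff_space L ->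
    perfect_set [set: L] -> [set: L] !=set0 -> [set: Gamma] !=set0 ->
    embeds_isometrically R (copies_space Gamma L) K ->
    has_cellular_family (perfect_kernel K) Gamma.
  move=> cL hL pL L0 G0; have [cX hX [i [d Xi]]] := copies_spaceP cL hL G0 L0.
  exact: (isometric_embedding_cellular cL pL L0 Xi cX hX K_compact K_nonempty).
have pI := @unit_interval_perfect R; have pD := cantor_perfect.
exists kappa; split=> //.
- apply: card_sup_nonempty supk => Gamma G0; split; first exact: cell_pos.
  by move=> /pos_isom; exact: isom_cell.
- apply: card_sup_nonempty supk => Gamma G0; split; last exact: isom_cell.
  by move=> /(cell_pos _ G0)/pos_isom.
move=> K_base.
(* This opens the second cycle: a cellular family gives a surjection, composition with it gives a
   lattice and algebra embedding, and [isom_cell] leads back because the Cantor space is perfect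
   too. *)
have cell_map Gamma : [set: Gamma] !=set0 ->
    has_cellular_family (perfect_kernel K) Gamma ->
    maps_continuously_onto K (copies_space Gamma cantor_space).
  move=> G0 /cellular_enumeration[U [oU UP Udisj]].
  have [_ hX [i [d Xi]]] := copies_spaceP cD hD G0 D0.
  have /choice[F /choice[phi FP]] c :=
    perfect_clopen_cantor_image K_compact K_hausdorff K_base (oU c) (UP c).
  apply: (copies_continuous_image (U := F) Xi K_compact _ (phi := phi))
    => // [c c' x||c|c].
  - have [_ FU _ _] := FP c; have [_ F'U _ _] := FP c'.
    by move=> /FU Ux /F'U; exact: Udisj.
  - by move=> c; case: (FP c).
  - by case: (FP c).
  - by case: (FP c).
split; apply: card_sup_nonempty supk => Gamma G0; split.
- exact: cell_map.
- by move=> /(@continuous_image_embeds R)/lat_isom; exact: isom_cell.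
- by move=> /(cell_map _ G0)/(@continuous_image_embeds R).
- by move=> /lat_isom; exact: isom_cell.
Qed.
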